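(* Let $M^2$ be a complete 2-dimensional manifold and let $\mathbf{g}: M^2\to \mathbb{S}^5$ be a minimal isometric immersion, with Gauss curvature $K$ and scalar normal curvature $K_N$. Then $\mathbf{g}$ is superminimal if and only if $$(K-1)^2-\frac{1}{4}K_N=0$$ identically on $M^2$.
   Context: $\mathbb{S}^5\subset\mathbb{R}^6$ is the unit sphere and $M^2$ carries the metric induced by $\mathbf{g}$. Let $\mathbf{e}_1,\mathbf{e}_2$ be a local orthonormal tangent frame and $\mathbf{e}_3,\mathbf{e}_4,\mathbf{e}_5$ a local orthonormal frame of the normal bundle of $\mathbf{g}$ in $\mathbb{S}^5$. The second fundamental form of $\mathbf{g}$ is $\mathbf{B}(\mathbf{e}_i,\mathbf{e}_j)=\mathbf{B}_{ij}=\sum_{\alpha=3}^5 h^\alpha_{ij}\mathbf{e}_\alpha$, with $h^\alpha_{ij}=h^\alpha_{ji}$. The immersion is minimal if $h^\alpha_{11}+h^\alpha_{22}=0$ for all $\alpha$. Gauss curvature: $K=1+\sum_{\alpha=3}^5\left(h^\alpha_{11}h^\alpha_{22}-(h^\alpha_{12})^2\right)$. Scalar normal curvature: $K_N=\sum_{i,j,\alpha,\beta}(R^\alpha_{\beta ij})^2$, where $i,j\in\{1,2\}$, $\alpha,\beta\in\{3,4,5\}$ and $R^\alpha_{\beta ij}=\sum_{k=1}^2\left(h^\alpha_{ki}h^\beta_{kj}-h^\alpha_{kj}h^\beta_{ki}\right)$. Superminimal: $\mathbf{g}$ is superminimal if it is minimal and at every point $p$ the curvature ellipse $\mathcal{E}_p=\{\mathbf{B}_p(X,X):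 X\in T_pM,\ \|X\|=1\}$ is a circle (possibly degenerate to a point); equivalently, $\mathbf{g}$ is minimal, $\|\mathbf{B}_{11}\|=\|\mathbf{B}_{12}\|$ and $\langle \mathbf{B}_{11},\mathbf{B}_{12}\rangle=0$ everywhere. *)

(* Defs.v *)
From HB Require Import structures.
From mathcomp Require Import all_boot all_order all_algebra.
From mathcomp Require Import all_classical all_reals all_analysis.

Set Implicit Arguments.
Unset Strict Implicit.
Unset Printing Implicit Defensive.
Import Order.TTheory GRing.Theory Num.Theory.
Import numFieldNormedType.Exports.

Local Open Scope classical_set_scope.
Local Open Scope ring_scope.

Section Euclidean.
Variables (R : realType) (n : nat).

(* The Euclidean inner product; the library norm on row vectors is the sup
   norm and is used for its topology only. *)
Definition dot (u v : 'rV[R]_n) : R := (u *m v^T) 0 0.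

(* [r = 0] is the degenerate circle. *)
Definition is_circle (C : set 'rV[R]_n) : Prop :=
  exists (c u v : 'rV[R]_n) (r : R),
    [/\ 0 <= r, dot u u = 1, dot v v = 1, dot u v = 0 &
        C = [set c + (r * cos t) *: u + (r * sin t) *: v | t in [set: R]]].

Variable m : nat.

(* The iterated partial derivative of [f] along the coordinate indices [s]. *)
Definition partials (s : seq 'I_m) (f : 'rV[R]_m -> 'rV[R]_n) :
    'rV[R]_m -> 'rV[R]_n :=
  foldr (fun i h x => 'D_(delta_mx 0 i) h x) f s.

(* Smoothness on an open set [U]: partial derivatives of every order exist and
   are differentiable, hence continuous, on [U]. *)
Definition smooth_on (U : set 'rV[R]_m) (f : 'rV[R]_m -> 'rV[R]_n) : Prop :=
  forall (s : seq 'I_m) (x : 'rV[R]_m), U x -> differentiable (partials s f) x.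

End Euclidean.

Lemma dot_row (R : realType) n m (A : 'M[R]_(m, n)) i j :
  dot (row i A) (row j A) = (A *m A^T) i j.
Proof. by rewrite /dot !mxE; apply: eq_bigr => k _; rewrite !mxE. Qed.

Lemma dot_eq0 (R : realType) n (u : 'rV[R]_n) : dot u u = 0 -> u = 0.
Proof.
rewrite /dot mxE => /eqP; rewrite psumr_eq0; last first.
  by move=> i _; rewrite mxE -expr2 sqr_ge0.
move=> /allP u0; apply/rowP => i; rewrite mxE.
by have /= := u0 i (mem_index_enum i); rewrite mxE mulf_eq0 orbb => /eqP.
Qed.

Lemma dot_ge0 (R : realType) n (u : 'rV[R]_n) : 0 <= dot u u.
Proof. by rewrite /dot mxE sumr_ge0// => i _; rewrite mxE -expr2 sqr_ge0. Qed.

Lemma gram_schmidt (R : realType) n m (A : 'M[R]_(m, n)) : row_free A ->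
  exists B : 'M[R]_m, (B *m A) *m (B *m A)^T = 1%:M.
Proof.
elim: m A => [|m IH]; first by exists 0; apply/matrixP => -[].
rewrite -[m.+1]/(1 + m)%N => A; rewrite -[A]vsubmxK.
set a := usubmx A; set A' := dsubmx A => freeA.
have freeA' : row_free A'.
  apply/row_freeP; have /row_freeP[C hC] := freeA.
  exists (rsubmx (C : 'M[R]_(n, 1 + m))).
  have := congr1 (fun X : 'M[R]_(1 + m) => drsubmx X) hC.
  rewrite -[C](@hsubmxK _ _ 1 m) mul_col_row block_mxKdr row_mxKr => ->.
  by rewrite (scalar_mx_block 1 m 1) block_mxKdr.
have [B' hB'] := IH _ freeA'; set N := B' *m A' in hB'.
pose w := a *m N^T *m B'; pose b := a - w *m A'.
have bN : b *m N^T = 0.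
  by rewrite mulmxBl /w -(mulmxA _ B' A') -/N -(mulmxA _ N) hB' mulmx1 subrr.
have b_neq0 : dot b b != 0.
  apply/eqP => /dot_eq0 b0.
  have /(row_free_inj freeA)/(congr1 (@lsubmx _ 1 1 m)) :
      row_mx 1%:M (- w) *m col_mx a A' = 0 *m col_mx a A'.
    by rewrite mul0mx mul_row_col mul1mx mulNmx.
  rewrite row_mxKl => /matrixP/(_ 0 0); rewrite !mxE /= => /eqP.
  by rewrite oner_eq0.
have b_gt0 : 0 < dot b b by rewrite lt_def b_neq0 dot_ge0.
pose s := (Num.sqrt (dot b b))^-1.
have s2 : s * s * dot b b = 1.
  by rewrite -expr2 exprVn sqr_sqrtr ?dot_ge0// mulVf.
exists (block_mx s%:M (- (s *: w)) 0 B').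
rewrite mul_block_col mul0mx add0r -/N.
have -> : s%:M *m a + - (s *: w) *m A' = s *: b.
  by rewrite mul_scalar_mx mulNmx -scalemxAl -scalerBr.
rewrite tr_col_mx mul_col_row hB' (scalar_mx_block 1 m 1); congr block_mx.
- apply/matrixP => i j; rewrite !ord1 linearZ/= -scalemxAl -scalemxAr scalerA.
  by rewrite mxE -/(dot b b) s2 mxE.
- by rewrite -scalemxAl bN scaler0.
- rewrite linearZ/= -scalemxAr -[N *m _]trmxK trmx_mul trmxK bN.
  by rewrite trmx0 scaler0.
Qed.

(* A smooth 2-manifold without boundary, given by an atlas. The total functions
   [chart i] and [param i] are meaningful only on [chart_dom i] and on
   [chart i @` chart_dom i], where they are mutually inverse. [chart_at p] is
   a preferred chart around [p]. *)
Record surface (R : realType) := Surface {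
  surface_sort :> topologicalType;
  surface_hausdorff : hausdorff_space surface_sort;
  surface_second_countable : @second_countable surface_sort;
  chart_index : Type;
  chart_dom : chart_index -> set surface_sort;
  chart : chart_index -> surface_sort -> 'rV[R]_2;
  param : chart_index -> 'rV[R]_2 -> surface_sort;
  chart_at : surface_sort -> chart_index;
  chart_at_dom : forall p, chart_dom (chart_at p) p;
  chart_dom_open : forall i, open (chart_dom i);
  chart_img_open : forall i, open (chart i @` chart_dom i);
  chartK : forall i p, chart_dom i p -> param i (chart i p) = p;
  chart_continuous : forall i, {within chart_dom i, continuous (chart i)};
  param_continuous : forall i,
    {within chart i @` chart_dom i, continuous (param i)};
  transition_smooth : forall i j,
    smooth_on (chart i @` (chart_dom i `&` chart_dom j)) (chart j \o param i)
}.

Section SurfaceInSphere.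
Variables (R : realType) (M : surface R) (g : M -> 'rV[R]_6).

Definition smooth_map : Prop :=
  forall i : chart_index M,
    smooth_on (chart i @` chart_dom i) (g \o param i).

(* [T_pM] is represented by ['rV[R]_2], the coordinates of tangent vectors in
   the chart [chart_at p]; [local_map p] and [coord p] are the expressions of
   [g] and of the point [p] in that chart. *)
Definition local_map (p : M) : 'rV[R]_2 -> 'rV[R]_6 :=
  g \o param (chart_at p).

Definition coord (p : M) : 'rV[R]_2 := chart (chart_at p) p.

(* Row vectors act on the left: the differential is [X |-> X *m dmap p]. *)
Definition dmap (p : M) : 'M[R]_(2, 6) := jacobian (local_map p) (coord p).

Definition sphere_immersion : Prop :=
  [/\ forall p, dot (g p) (g p) = 1, smooth_map &
      forall p, \rank (dmap p) = 2%N].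

(* The metric of [M] is the one induced by [g]. *)
Definition metric (p : M) (X Y : 'rV[R]_2) : R :=
  dot (X *m dmap p) (Y *m dmap p).

(* Curves are parametrized by the whole line, only [0, 1] being used. Since a
   piecewise [C^1] path on [0, 1] can be reparametrized so as to stop at its
   break points and end points, this gives the usual Riemannian distance. *)
Definition C1_curve (c : R -> M) : Prop :=
  continuous c /\
  forall (i : chart_index M) (t : R), chart_dom i (c t) ->
    derivable (chart i \o c) t 1 /\
    {for t, continuous (derive1 (chart i \o c))}.

Definition velocity (c : R -> M) (t : R) : 'rV[R]_2 :=
  derive1 (chart (chart_at (c t)) \o c) t.

Definition curve_length (c : R -> M) : \bar R :=
  (\int[lebesgue_measure]_(t in `[0%R, 1%R])
     (Num.sqrt (metric (c t) (velocity c t) (velocity c t)))%:E)%E.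

(* The value is [+oo] for points in different components. *)
Definition riemannian_dist (p q : M) : \bar R :=
  ereal_inf [set curve_length c | c in
    [set c : R -> M | [/\ C1_curve c, c 0 = p & c 1 = q]]].

Definition complete_surface : Prop :=
  forall u : nat -> M,
    (forall eps : R, 0 < eps -> exists N : nat, forall m n : nat,
        (N <= m)%N -> (N <= n)%N -> (riemannian_dist (u m) (u n) < eps%:E)%E) ->
    exists p : M, forall eps : R, 0 < eps -> exists N : nat, forall n : nat,
        (N <= n)%N -> (riemannian_dist (u n) p < eps%:E)%E.

(* Its row space is the span of [g p] and of [dg(T_pM)]: the orthogonal
   complement in R^6 of the normal space of [g] in the sphere. *)
Definition radial_tangent_mx (p : M) : 'M[R]_(1 + 2, 6) :=
  col_mx (g p) (dmap p).

(* Its row space is the normal space of [g] in the sphere at [p]. *)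
Definition normal_mx (p : M) : 'M[R]_6 := kermx (radial_tangent_mx p)^T.

(* The second fundamental form of [g] in the sphere: [Y] is extended to the
   field with constant coordinates, and projecting out [g p] replaces the flat
   connection of R^6 by that of the sphere. *)
Definition second_ff (p : M) (X Y : 'rV[R]_2) : 'rV[R]_6 :=
  'D_X (fun x => 'D_Y (local_map p) x) (coord p)
    *m proj_mx (normal_mx p) <<radial_tangent_mx p>>%MS.

(* A pair [(E, N)]: the rows of [E] are an orthonormal basis of [T_pM] and those
   of [N] an orthonormal basis of the normal space. *)
Definition adapted_frame (p : M) (F : 'M[R]_2 * 'M[R]_(3, 6)) : Prop :=
  [/\ forall i j, metric p (row i F.1) (row j F.1) = (i == j)%:R,
      (F.2 <= normal_mx p)%MS &
      forall a b, dot (row a F.2) (row b F.2) = (a == b)%:R].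

(* The coefficients [h^a_ij]; the normal indices 3, 4, 5 are shifted to
   0, 1, 2. *)
Definition ff_coef (p : M) (F : 'M[R]_2 * 'M[R]_(3, 6))
    (a : 'I_3) (i j : 'I_2) : R :=
  dot (second_ff p (row i F.1) (row j F.1)) (row a F.2).

Definition minimal : Prop :=
  forall p F, adapted_frame p F ->
  forall a, ff_coef p F a 0 0 + ff_coef p F a 1 1 = 0.

(* The curvatures do not depend on the adapted frame; one is chosen at each
   point, see [adapted_frame_atP]. *)
Definition adapted_frame_at (p : M) : 'M[R]_2 * 'M[R]_(3, 6) :=
  xget (0, 0) [set F | adapted_frame p F].

Lemma adapted_frame_atP p :
  sphere_immersion -> adapted_frame p (adapted_frame_at p).
Proof.
case=> _ _ rk2.
have [E hE] : exists E : 'M[R]_2, (E *m dmap p) *m (E *m dmap p)^T = 1%:M.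
  by apply: gram_schmidt; rewrite /row_free rk2.
have rkN : (3 <= \rank (normal_mx p))%N.
  rewrite mxrank_ker mxrank_tr leq_subRL; last exact: rank_leq_col.
  by rewrite addnC -(leq_subRL _ (isT : 3 <= 6)%N) (leq_trans (rank_leq_row _)).
pose A : 'M[R]_(3, 6) := pid_mx 3 *m row_base (normal_mx p).
have freeA : row_free A.
  by rewrite /row_free mxrankMfree ?row_base_free// rank_pid_mx.
have [N hN] := gram_schmidt freeA.
have exF : adapted_frame p (E, N *m A).
  split=> /=.
  - by move=> i j; rewrite /metric -!row_mul dot_row hE mxE.
  - rewrite mulmxA; apply: submx_trans (submxMl _ _) _.
    by rewrite eq_row_base.
  - by move=> a b; rewrite dot_row hN mxE.
exact: (@xgetPex _ (0, 0) [set F | adapted_frame p F]) (ex_intro _ _ exF).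
Qed.

Definition gauss_curvature (p : M) : R :=
  let h := ff_coef p (adapted_frame_at p) in
  1 + \sum_(a < 3) (h a 0 0 * h a 1 1 - h a 0 1 ^+ 2).

Definition normal_curvature_coef (p : M) (a b : 'I_3) (i j : 'I_2) : R :=
  let h := ff_coef p (adapted_frame_at p) in
  \sum_(k < 2) (h a k i * h b k j - h a k j * h b k i).

Definition scalar_normal_curvature (p : M) : R :=
  \sum_(i < 2) \sum_(j < 2) \sum_(a < 3) \sum_(b < 3)
    normal_curvature_coef p a b i j ^+ 2.

Definition curvature_ellipse (p : M) : set 'rV[R]_6 :=
  [set second_ff p X X | X in [set X | Num.sqrt (metric p X X) = 1]].

Definition superminimal : Prop :=
  minimal /\ forall p, is_circle (curvature_ellipse p).

End SurfaceInSphere.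

(* Main.v *)
Require Import Defs.
From mathcomp Require Import all_boot all_order all_algebra.
From mathcomp Require Import all_classical all_reals all_analysis.
From mathcomp Require Import ring lra.

(** Both sides are conditions on the second fundamental form [B] at a single
    point [p], and they agree point by point. Fix an adapted frame at [p] with
    tangent vectors [e0], [e1], and put [a = B(e0, e0)] and [b = B(e0, e1)].
    Minimality gives [B(e1, e1) = - a].

    On the one hand the unit vector [cos s e0 + sin s e1] is sent by [B] to
    [cos 2s a + sin 2s b], so the curvature ellipse is the set of all
    [cos t a + sin t b] ([curvature_ellipseE]). That set is symmetric about the
    origin; if it is a circle, its centre is therefore the origin, and it is one
    exactly when [|a| = |b|] and [a] is orthogonal to [b]
    ([ellipse_is_circle]).

    On the other hand [K - 1 = - (|a|^2 + |b|^2)] and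
    [K_N = 16 (|a|^2 |b|^2 - <a, b>^2)], whence
    [(K - 1)^2 - K_N / 4 = (|a|^2 - |b|^2)^2 + 4 <a, b>^2]
    ([ff_coef_curvature]). This sum of squares vanishes under the same condition
    on [a] and [b].

    Two facts about [B] enter. It is symmetric, which comes from the equality of
    mixed second derivatives ([schwarz_scalar], [hessianC]). And inner products
    of its values can be computed from the coefficients [h^a_ij], because the
    three normal vectors of the frame span the whole normal space: the position
    vector is orthogonal to the tangent plane ([dmap_radial]), so the radial and
    tangent directions together have rank 3 ([rank_radial_tangent]). *)

Set Implicit Arguments.
Unset Strict Implicit.
Unset Printing Implicit Defensive.
Import Order.TTheory GRing.Theory Num.Theory.
Import numFieldNormedType.Exports.

Local Open Scope classical_set_scope.
Local Open Scope ring_scope.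

(** * Equality of mixed second derivatives *)

Section Schwarz.
Variables (R : realType) (V : normedModType R).
Implicit Types (f : V -> R) (x v w : V) (h : R).

Lemma is_derive_line f v a (t : R) : differentiable f (t *: v + a) ->
  is_derive t 1 (fun s : R => f (s *: v + a)) ('D_v f (t *: v + a)).
Proof.
move=> df.
have dl : is_diff t (fun s : R => s *: v + a) (fun s : R => s *: v).
  apply: (@is_diff_eq _ _ _ _ ((fun s : R => s *: v) + (fun=> 0))).
  by apply: funext => s /=; rewrite [LHS]addr0.
have dfl : differentiable (f \o (fun s : R => s *: v + a)) t.
  by apply: differentiable_comp.
apply: DeriveDef; first exact: diff_derivable.
rewrite (deriveE _ dfl) diff_comp// /= diff_val scale1r deriveE//.
Qed.

(** Symmetric in [v] and [w]; for small [h] it is close to [h^2] times the mixed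
    second derivative, whichever of [v] and [w] is differentiated first. *)
Definition second_difference f x v w h : R :=
  f (h *: v + (h *: w + x)) - f (h *: v + x) - (f (h *: w + x) - f x).

Lemma second_differenceC f x v w h :
  second_difference f x v w h = second_difference f x w v h.
Proof. by rewrite /second_difference addrCA; ring. Qed.

Lemma diff_near_bound f x (e : R) : 0 < e -> differentiable f x ->
  \forall k \near 0, `|f (k + x) - f x - 'D_k f x| <= e * `|k|.
Proof.
move=> e0 df; have /eqaddoP/(_ e e0) := diff_locally df.
apply: filterS => k /=; rewrite deriveE// -[X in `|X| <= _]/(_ - (_ + _)).
by rewrite /= opprD addrA.
Qed.

(** The mean value theorem for [s |-> f (s v + h w + x) - f (s v + x)] on [0, h]
    turns the second difference into [h] times a difference of values of [g],
    which the first order expansion of [g] at [x] controls. Naming the derivative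
    [g] lets [schwarz_row] take for it a coordinate of the derivative of a
    vector-valued map, which agrees with ['D_v f] near [x] but is not the same
    function. *)
Lemma second_difference_near f g x v w (e : R) : 0 < e ->
  (\forall y \near x, differentiable f y /\ 'D_v f y = g y) ->
  differentiable g x ->
  exists2 d : R, 0 < d & forall h, 0 < h < d ->
   `|second_difference f x v w h - h ^+ 2 * 'D_w g x| <= e * h ^+ 2.
Proof.
move=> e0 nf dg.
(* [c] bounds the total length, in units of [h], of the two displacements
   [s v] and [s v + h w]; adding 1 makes it positive. *)
pose c : R := `|v| + `|v| + `|w| + 1.
have c0 : 0 < c by rewrite ltr_wpDl// !addr_ge0.
have : \forall k \near (0 : V),
    (differentiable f (k + x) /\ 'D_v f (k + x) = g (k + x)) /\
    `|g (k + x) - g x - 'D_k g x| <= e / c * `|k|.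
  have nf0 : \forall k \near (0 : V),
      differentiable f (k + x) /\ 'D_v f (k + x) = g (k + x).
    move: nf; rewrite (near_shift 0 x) subr0.
    exact.
  have ec0 : 0 < e / c by rewrite divr_gt0.
  by apply: filterS2 nf0 (diff_near_bound ec0 dg).
move=> /nbhs_norm0P[r /= r0 Hr].
exists (r / c); first by rewrite divr_gt0.
move=> h /andP[h0 hd].
have hc : h * c < r by rewrite -ltr_pdivlMr.
have small1 s : 0 <= s <= h -> `|s *: v| <= h * `|v|.
  by move=> /andP[s0 sh]; rewrite normrZ ger0_norm// ler_wpM2r.
have small2 s : 0 <= s <= h -> `|s *: v + h *: w| <= h * (`|v| + `|w|).
  move=> sh; apply: le_trans (ler_normD _ _) _.
  by rewrite mulrDr lerD ?small1// normrZ gtr0_norm.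
have v0 := normr_ge0 v; have w0 := normr_ge0 w.
have lt1 s : 0 <= s <= h -> `|s *: v| < r.
  by move=> /small1 /le_lt_trans; apply; apply: le_lt_trans hc; rewrite /c; nra.
have lt2 s : 0 <= s <= h -> `|s *: v + h *: w| < r.
  by move=> /small2 /le_lt_trans; apply; apply: le_lt_trans hc; rewrite /c; nra.
pose phi s := f (s *: v + (h *: w + x)) - f (s *: v + x).
pose psi s := g (s *: v + (h *: w + x)) - g (s *: v + x).
have dphi s : s \in `[0, h]%R -> is_derive s 1 phi (psi s).
  rewrite in_itv /= => sh; apply: is_deriveB.
    rewrite addrA; have [[df <-] _] := Hr _ (lt2 _ sh); rewrite -addrA in df *.
    exact: is_derive_line.
  by have [[df <-] _] := Hr _ (lt1 _ sh); exact: is_derive_line.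
have dphio s : s \in `]0, h[%R -> is_derive s 1 phi (psi s).
  by move=> sh; apply: dphi; apply: subset_itv_oo_cc sh.
have cphi : {within `[0, h], continuous phi}.
  by apply: derivable_within_continuous => s /dphi [].
have [s sh] := MVT h0 dphio cphi.
have {}sh : 0 <= s <= h by move: sh; rewrite in_itv /= => /andP[/ltW -> /ltW ->].
rewrite /psi {1 2}/phi !scale0r !add0r subr0 => E.
rewrite /second_difference E addrA.
have [_ B1] := Hr _ (lt1 _ sh); have [_ B2] := Hr _ (lt2 _ sh).
have Dk k : 'D_k g x = 'd g x k by rewrite deriveE.
rewrite !Dk in B1 B2 *.
have dlin : 'd g x (s *: v + h *: w) = 'd g x (s *: v) + h * 'd g x w.
  by rewrite linearD; congr (_ + _); exact: linearZ.
rewrite dlin in B2.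
set A2 := g _ in B2 *; set A1 := g _ in B1 *.
have -> : (A2 - A1) * h - h ^+ 2 * 'd g x w =
   h * ((A2 - g x - ('d g x (s *: v) + h * 'd g x w))
        - (A1 - g x - 'd g x (s *: v))) by ring.
rewrite normrM gtr0_norm// expr2 mulrCA ler_pM2l//.
apply: le_trans (ler_normB _ _) _.
apply: le_trans (lerD B2 B1) _.
rewrite -mulrDr mulrAC ler_pdivrMr// -mulrA ler_pM2l//.
have := small1 _ sh; have := small2 _ sh; rewrite /c; nra.
Qed.

(** [h^2] times either mixed derivative approximates the same second difference,
    up to an arbitrarily small multiple of [h^2]. *)
Lemma schwarz_scalar f gv gw x v w :
  (\forall y \near x, differentiable f y /\ 'D_v f y = gv y) ->
  (\forall y \near x, differentiable f y /\ 'D_w f y = gw y) ->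
  differentiable gv x -> differentiable gw x -> 'D_w gv x = 'D_v gw x.
Proof.
move=> nv nw dv dw; apply/eqP; rewrite -subr_eq0 -normr_le0.
apply/ler_addgt0Pl => e e0; rewrite addr0.
have e20 : 0 < e / 2 by rewrite divr_gt0.
have [d1 d10 H1] := second_difference_near w e20 nv dv.
have [d2 d20 H2] := second_difference_near v e20 nw dw.
pose h := Num.min d1 d2 / 2.
have m0 : 0 < Num.min d1 d2 by rewrite lt_min d10.
have h0 : 0 < h by rewrite divr_gt0.
have /andP[hd1 hd2] : (h < d1) && (h < d2) by rewrite -lt_min /h; lra.
have := H1 h; rewrite h0 hd1 => /(_ isT) {}H1.
have := H2 h; rewrite h0 hd2 second_differenceC => /(_ isT) {}H2.
have h20 : 0 < h ^+ 2 by rewrite exprn_gt0.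
rewrite -(ler_pM2l h20) -{1}(gtr0_norm h20) -normrM.
set a := 'D_w _ x in H1 *; set b := 'D_v _ x in H2 *.
set S := second_difference _ _ _ _ _ in H1 H2.
have -> : h ^+ 2 * (a - b) = (S - h ^+ 2 * b) - (S - h ^+ 2 * a) by ring.
apply: le_trans (ler_normB _ _) _; apply: le_trans (lerD H2 H1) _.
by rewrite -mulrDl -splitr mulrC.
Qed.

End Schwarz.

(** * Inner products and circles *)

Section Dot.
Variables (R : realType) (n : nat).
Implicit Types u v w : 'rV[R]_n.

Lemma dotE u v : dot u v = \sum_i u 0 i * v 0 i.
Proof. by rewrite /dot mxE; apply: eq_bigr => i _; rewrite mxE. Qed.

Lemma dotC u v : dot u v = dot v u.
Proof. by rewrite !dotE; apply: eq_bigr => i _; rewrite mulrC. Qed.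

Lemma dotDl u v w : dot (u + v) w = dot u w + dot v w.
Proof. by rewrite /dot mulmxDl mxE. Qed.

Lemma dotZl (k : R) u v : dot (k *: u) v = k * dot u v.
Proof. by rewrite /dot -scalemxAl mxE. Qed.

Lemma dotDr u v w : dot u (v + w) = dot u v + dot u w.
Proof. by rewrite dotC dotDl ![dot _ u]dotC. Qed.

Lemma dotZr (k : R) u v : dot u (k *: v) = k * dot u v.
Proof. by rewrite dotC dotZl dotC. Qed.

End Dot.

Lemma dot_orthonormal_rows (R : realType) n m (N : 'M[R]_(m, n))
    (u v : 'rV[R]_n) :
  N *m N^T = 1%:M -> (u <= N)%MS -> (v <= N)%MS ->
  dot u v = \sum_a dot u (row a N) * dot v (row a N).
Proof.
move=> NN1 /submxP[x ->] /submxP[y ->].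
have coef z a : dot (z *m N) (row a N) = z 0 a.
  rewrite -[z in RHS]mulmx1 -NN1 mulmxA mxE dotE.
  by apply: eq_bigr => i _; rewrite !mxE.
under eq_bigr do rewrite !coef.
by rewrite -dotE {1}/dot trmx_mul mulmxA -(mulmxA x) NN1 mulmx1.
Qed.

Section Circle.
Variables (R : realType).

Lemma circle_param (x y : R) : x ^+ 2 + y ^+ 2 = 1 ->
  exists t, cos t = x /\ sin t = y.
Proof.
move=> xy1.
have x1 : -1 <= x <= 1.
  have y2 := sqr_ge0 y; apply/andP; split; nra.
have cx : cos (acos x) = x by apply: acosK; rewrite in_itv.
have sx : sin (acos x) = `|y|.
  by rewrite sin_acos// -xy1 addrAC subrr add0r sqrtr_sqr.
have [y0|y0] := leP 0 y.
  by exists (acos x); rewrite cx sx ger0_norm.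
by exists (- acos x); rewrite cosN sinN cx sx ltr0_norm// opprK.
Qed.

Definition ellipse n (a b : 'rV[R]_n) : set 'rV[R]_n :=
  [set cos t *: a + sin t *: b | t in [set: R]].

(** Opposite points of the ellipse lie on the circle, so every point of it is
    orthogonal to the centre [c]. As [c] is the midpoint of two such points, it
    is orthogonal to itself, hence zero. *)
Lemma ellipse_circle_radius n (a b c u v : 'rV[R]_n) (r : R) :
  dot u u = 1 -> dot v v = 1 -> dot u v = 0 ->
  ellipse a b = [set c + (r * cos t) *: u + (r * sin t) *: v | t in [set: R]] ->
  forall x, ellipse a b x -> dot x x = r ^+ 2.
Proof.
move=> u1 v1 uv0 E.
have sym x : ellipse a b x -> ellipse a b (-1 *: x).
  move=> [t _ <-]; exists (t + pi) => //.
  by rewrite cosDpi sinDpi !scaleNr scale1r opprD.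
have onC x : ellipse a b x -> dot x x = r ^+ 2 + 2 * dot x c - dot c c.
  rewrite E => -[t _ <-].
  have cs := cos2Dsin2 t.
  rewrite !(dotDl, dotDr, dotZl, dotZr) u1 v1 (dotC v u) uv0 (dotC c u) (dotC c v).
  transitivity (r ^+ 2 * (cos t ^+ 2 + sin t ^+ 2) + dot c c
    + 2 * (r * cos t * dot u c + r * sin t * dot v c)); first ring.
  rewrite cs; ring.
have xc0 x : ellipse a b x -> dot x c = 0.
  move=> Ex; have := onC _ (sym _ Ex); have := onC _ Ex.
  rewrite !(dotZl, dotZr); lra.
have cc0 : dot c c = 0.
  have : ellipse a b (c + (r * cos 0) *: u + (r * sin 0) *: v) by rewrite E; exists 0.
  have : ellipse a b (c + (r * cos pi) *: u + (r * sin pi) *: v) by rewrite E; exists pi.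
  rewrite cos0 sin0 cospi sinpi => /xc0 + /xc0.
  rewrite !(dotDl, dotDr, dotZl, dotZr); lra.
by move=> x Ex; rewrite onC// xc0// cc0; ring.
Qed.

(** Once the centre is the origin, the points [a], [b] and a third one of the
    ellipse have the same norm. Conversely [a] and [b] themselves, rescaled to
    unit length, are the axes of the circle. *)
Lemma ellipse_is_circle n (a b : 'rV[R]_n.+2) :
  is_circle (ellipse a b) <-> dot a a = dot b b /\ dot a b = 0.
Proof.
split=> [[c [u [v [r [r0 u1 v1 uv0 E]]]]]|[ab ab0]].
  have H t := ellipse_circle_radius u1 v1 uv0 E (imageT _ t).
  have Ha := H 0; have Hb := H (pi / 2).
  rewrite cos0 sin0 scale1r scale0r addr0 in Ha.
  rewrite cos_pihalf sin_pihalf scale1r scale0r add0r in Hb.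
  split; first by rewrite Ha Hb.
  (* Any point off the two axes makes the cross term [dot a b] visible; the
     triple 3, 4, 5 gives a rational one. *)
  have [t [ct st]] : exists t : R, cos t = 3 / 5 /\ sin t = 4 / 5.
    by apply: circle_param; field.
  have := H t; rewrite ct st !(dotDl, dotDr, dotZl, dotZr) Ha Hb (dotC b a).
  lra.
(* A degenerate ellipse has no direction of its own, and any orthonormal pair
   serves as axes of the point circle; this uses that the dimension is at
   least 2. *)
have [a0|an0] := eqVneq (dot a a) 0.
  have b0 : b = 0 by apply: dot_eq0; rewrite -ab.
  rewrite (dot_eq0 a0) b0.
  pose I : 'M[R]_n.+2 := 1%:M.
  have II i j : dot (row i I) (row j I) = (i == j)%:R.
    by rewrite dot_row trmx1 mulmx1 mxE.
  exists 0, (row 0 I), (row 1 I), 0; rewrite !II; split => //.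
  by congr image; apply: funext => t; rewrite !mul0r !scale0r !scaler0 !addr0.
set r := Num.sqrt (dot a a).
have r2 : r * r = dot a a by rewrite -expr2 sqr_sqrtr ?dot_ge0.
have r0 : r != 0 by apply: contra_neq an0 => r0; rewrite -r2 r0 mul0r.
have inv (d : R) : d = r * r -> r^-1 * (r^-1 * d) = 1 by move=> ->; field.
exists 0, (r^-1 *: a), (r^-1 *: b), r; split.
- exact: sqrtr_ge0.
- by rewrite dotZl dotZr inv.
- by rewrite dotZl dotZr inv// -ab.
- by rewrite dotZl dotZr ab0 !mulr0.
congr image; apply: funext => t.
have can d : r * d * r^-1 = d by rewrite mulrAC mulfV ?mul1r.
by rewrite add0r !scalerA !can.
Qed.

End Circle.

(** * The second derivative as a symmetric bilinear form *)

Section HessianRow.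
Variables (R : realType) (m n : nat).
Implicit Types (f : 'rV[R]_m -> 'rV[R]_n) (x : 'rV[R]_m).

Lemma derive_sum_partials f x (X : 'rV[R]_m) : differentiable f x ->
  'D_X f x = \sum_i X 0 i *: 'D_(delta_mx 0 i) f x.
Proof.
move=> df; rewrite !deriveE// {1}(row_sum_delta X) linear_sum.
by apply: eq_bigr => i _; rewrite linearZ deriveE.
Qed.

Lemma schwarz_row f gv gw x v w :
  (\forall y \near x, differentiable f y /\ 'D_v f y = gv y) ->
  (\forall y \near x, differentiable f y /\ 'D_w f y = gw y) ->
  differentiable gv x -> differentiable gw x -> 'D_w gv x = 'D_v gw x.
Proof.
move=> nv nw dv dw; apply/rowP => k.
have coordD (h : 'rV[R]_m -> 'rV[R]_n) (y : 'rV[R]_m) : differentiable h y ->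
    differentiable (fun z => h z 0 k : R) y.
  move=> dh; apply: (@differentiable_comp _ _ _ _ h (fun M : 'rV[R]_n => M 0 k)) => //.
  exact: differentiable_coord.
have deriveD (h : 'rV[R]_m -> 'rV[R]_n) (y u : 'rV[R]_m) : differentiable h y ->
    ('D_u h y) 0 k = 'D_u (fun z => h z 0 k : R) y.
  by move=> dh; rewrite derive_mx ?mxE//; exact: diff_derivable.
rewrite !deriveD//.
apply: (@schwarz_scalar _ _ (fun z => f z 0 k)); try exact: coordD.
  by apply: filterS nv => y [df <-]; rewrite -deriveD//; split=> //; exact: coordD.
by apply: filterS nw => y [df <-]; rewrite -deriveD//; split=> //; exact: coordD.
Qed.

Variables (U : set 'rV[R]_m) (f : 'rV[R]_m -> 'rV[R]_n) (x : 'rV[R]_m).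
Hypotheses (U_open : open U) (Ux : U x) (f_smooth : smooth_on U f).

Definition hessian (X Y : 'rV[R]_m) := 'D_X (fun y => 'D_Y f y) x.

Lemma near_domain : \forall y \near x, U y.
Proof. exact: open_nbhs_nbhs. Qed.

Lemma smooth_differentiable y : U y -> differentiable f y.
Proof. by move=> Uy; exact: (f_smooth [::] Uy). Qed.

Lemma partial_differentiable i : differentiable (fun y => 'D_(delta_mx 0 i) f y) x.
Proof. exact: (f_smooth [:: i] Ux). Qed.

(** Smoothness only speaks of partial derivatives, so [Y] is expanded first, on
    the whole neighbourhood [U], and then [X] at the point [x]. *)
Lemma hessian_partials X Y :
  hessian X Y = \sum_i \sum_j (X 0 i * Y 0 j) *: hessian (delta_mx 0 i) (delta_mx 0 j).
Proof.
rewrite exchange_big /= /hessian.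
rewrite (@near_eq_derive _ _ _ _
  (\sum_j (Y 0 j \*: (fun y => 'D_(delta_mx 0 j) f y)))); last first.
  apply: filterS near_domain => y Uy.
  rewrite derive_sum_partials; last exact: smooth_differentiable.
  by rewrite fct_sumE.
have dj j v : derivable (fun y => 'D_(delta_mx 0 j) f y) x v.
  apply: diff_derivable; exact: partial_differentiable.
rewrite derive_sum => [|j]; last exact: derivableZ.
apply: eq_bigr => j _; rewrite deriveZ//.
rewrite derive_sum_partials; last exact: partial_differentiable.
by rewrite scaler_sumr; apply: eq_bigr => i _; rewrite scalerA mulrC.
Qed.

Lemma hessian_partialsC i j :
  hessian (delta_mx 0 i) (delta_mx 0 j) = hessian (delta_mx 0 j) (delta_mx 0 i).
Proof.
apply: schwarz_row; try exact: partial_differentiable.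
- apply: filterS near_domain => y Uy.
  by split; first exact: smooth_differentiable.
- apply: filterS near_domain => y Uy.
  by split; first exact: smooth_differentiable.
Qed.

Lemma hessianC X Y : hessian X Y = hessian Y X.
Proof.
rewrite [LHS]hessian_partials [RHS]hessian_partials [RHS]exchange_big /=.
apply: eq_bigr => i _; apply: eq_bigr => j _.
by rewrite hessian_partialsC (mulrC (X 0 i)).
Qed.

Lemma hessianPl k X X' Y : hessian (k *: X + X') Y = k *: hessian X Y + hessian X' Y.
Proof.
rewrite 3!hessian_partials scaler_sumr -big_split; apply: eq_bigr => i _ /=.
rewrite scaler_sumr -big_split; apply: eq_bigr => j _ /=.
by rewrite !mxE scalerA -scalerDl; congr (_ *: _); ring.
Qed.

End HessianRow.

(** * The second fundamental form in an adapted frame *)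

Section Sphere.
Variables (R : realType) (m n : nat).

Lemma sphere_tangent (f : 'rV[R]_m -> 'rV[R]_n) x v :
  (forall y, dot (f y) (f y) = 1) -> differentiable f x ->
  dot ('D_v f x) (f x) = 0.
Proof.
move=> f1 df; pose fk k y : R := f y 0 k.
have dfk k : derivable (fk k) x v.
  by have /derivable_mxP/(_ 0 k) := @diff_derivable _ _ _ _ _ v df.
have : 'D_v (\sum_k (fk k * fk k)) x = 0.
  rewrite (_ : \sum_k _ = cst 1) ?derive_cst//.
  by apply: funext => y; rewrite -[RHS](f1 y) dotE fct_sumE.
rewrite derive_sum => [|k]; last exact: derivableM.
under eq_bigr do rewrite deriveM//.
have E : dot ('D_v f x) (f x) = \sum_k fk k x *: 'D_v (fk k) x.
  rewrite dotE derive_mx; last exact: diff_derivable.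
  by apply: eq_bigr => k _; rewrite mxE mulrC.
rewrite big_split /= -E; lra.
Qed.

End Sphere.

Section Surface.
Variables (R : realType) (M : surface R) (g : M -> 'rV[R]_6).
Hypothesis g_immersion : sphere_immersion g.
Variable p : M.

Let U := chart (chart_at p) @` chart_dom (chart_at p).
Let U_open : open U. Proof. exact: chart_img_open. Qed.
Let Up : U (Defs.coord p). Proof. by exists p => //; exact: chart_at_dom. Qed.
Let f_smooth : smooth_on U (local_map g p).
Proof. by case: g_immersion => _ sm _; exact: sm. Qed.

Lemma local_map_coord : local_map g p (Defs.coord p) = g p.
Proof. by rewrite /local_map /Defs.coord /= chartK//; exact: chart_at_dom. Qed.

(* The projection onto the normal space is linear, so symmetry and bilinearity
   are inherited from the second derivative of [local_map g p]. *)
Let second_ffE X Y : second_ff g p X Y =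
  hessian (local_map g p) (Defs.coord p) X Y
    *m proj_mx (normal_mx g p) <<radial_tangent_mx g p>>%MS.
Proof. by []. Qed.

Lemma second_ffC X Y : second_ff g p X Y = second_ff g p Y X.
Proof. by rewrite !second_ffE (hessianC U_open Up f_smooth X Y). Qed.

Lemma second_ffPl k X X' Y :
  second_ff g p (k *: X + X') Y = k *: second_ff g p X Y + second_ff g p X' Y.
Proof.
by rewrite !second_ffE (hessianPl U_open Up f_smooth k X X' Y) mulmxDl scalemxAl.
Qed.

Lemma second_ff_diag x y X Y :
  second_ff g p (x *: X + y *: Y) (x *: X + y *: Y) =
  x ^+ 2 *: second_ff g p X X + (2 * x * y) *: second_ff g p X Y
  + y ^+ 2 *: second_ff g p Y Y.
Proof.
have Zl k V W : second_ff g p (k *: V) W = k *: second_ff g p V W.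
  have Z0 : second_ff g p 0 W = 0.
    have := second_ffPl 1 0 0 W.
    by rewrite !scale1r addr0 => /eqP; rewrite -subr_eq subrr eq_sym => /eqP.
  by rewrite -[k *: V]addr0 second_ffPl Z0 addr0.
have E V : second_ff g p (x *: X + y *: Y) V =
    x *: second_ff g p X V + y *: second_ff g p Y V by rewrite second_ffPl Zl.
rewrite E !(second_ffC _ (_ + _)) !E (second_ffC Y X).
move: (second_ff g p X X) (second_ff g p X Y) (second_ff g p Y Y) => a b c.
by apply/rowP => i; rewrite !mxE; ring.
Qed.

Lemma dmap_radial v : dot (v *m dmap g p) (g p) = 0.
Proof.
have df := smooth_differentiable f_smooth Up.
rewrite /dmap -deriveEjacobian// -local_map_coord.
by apply: sphere_tangent => // y; case: g_immersion => + _ _; apply.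
Qed.

(** The tangent plane is orthogonal to the nonzero vector [g p], so it meets the
    line of [g p] trivially. *)
Lemma rank_radial_tangent : \rank (radial_tangent_mx g p) = 3.
Proof.
have [g1 _ rk] := g_immersion.
have gp0 : g p != 0.
  apply: contra_eq_neq (g1 p) => ->; rewrite dotE big1 ?[0 == _]eq_sym ?oner_eq0// => i _.
  by rewrite mxE mul0r.
have cap0 : (g p :&: dmap g p)%MS = 0.
  apply/eqP; rewrite -submx0; apply/row_subP => i.
  have := row_sub i (g p :&: dmap g p)%MS; rewrite sub_capmx.
  move=> /andP[/sub_rVP[k ->] /submxP[v kv]].
  have := dmap_radial v; rewrite -kv dotZl g1 mulr1 => ->.
  by rewrite scale0r sub0mx.
by rewrite /radial_tangent_mx -addsmxE mxrank_disjoint_sum// rank_rV gp0 rk.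
Qed.

Variable F : 'M[R]_2 * 'M[R]_(3, 6).
Hypothesis F_adapted : adapted_frame g p F.

Lemma frame_normal_orthonormal : F.2 *m F.2^T = 1%:M.
Proof.
by have [_ _ NN] := F_adapted; apply/matrixP => a b; rewrite -dot_row NN mxE.
Qed.

(** [proj_mx] lands in the normal space by construction; the normal vectors of
    the frame are three independent vectors in it, and its dimension is
    [6 - 3]. *)
Lemma second_ff_normal X Y : (second_ff g p X Y <= F.2)%MS.
Proof.
have [_ sN _] := F_adapted.
have rkN : \rank F.2 = 3.
  apply/eqP; change (row_free F.2); apply/row_freeP.
  by exists F.2^T; exact: frame_normal_orthonormal.
have [_ rkP] := mxrank_leqif_sup sN.
have : (normal_mx g p <= F.2)%MS.
  by rewrite -rkP rkN mxrank_ker mxrank_tr rank_radial_tangent.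
by apply: submx_trans; exact: proj_mx_sub.
Qed.

Lemma dot_second_ff X Y Z W :
  dot (second_ff g p X Y) (second_ff g p Z W) =
  \sum_a dot (second_ff g p X Y) (row a F.2) * dot (second_ff g p Z W) (row a F.2).
Proof.
exact: dot_orthonormal_rows frame_normal_orthonormal (second_ff_normal _ _)
  (second_ff_normal _ _).
Qed.

Let e0 := row 0 F.1.
Let e1 := row 1 F.1.
Hypothesis h_minimal : forall a, ff_coef g p F a 0 0 + ff_coef g p F a 1 1 = 0.

Lemma second_ff_traceless : second_ff g p e1 e1 = - second_ff g p e0 e0.
Proof.
have B2 v : (v <= F.2)%MS -> (forall a, dot v (row a F.2) = 0) -> v = 0.
  move=> vN v0; apply: dot_eq0.
  rewrite (dot_orthonormal_rows frame_normal_orthonormal vN vN) big1// => a _.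
  by rewrite v0 mul0r.
apply/eqP; rewrite -addr_eq0; apply/eqP/B2.
  by rewrite addmx_sub ?second_ff_normal.
by move=> a; rewrite dotDl addrC; exact: h_minimal.
Qed.

Lemma metric_frame (x : 'rV[R]_2) : metric g p (x *m F.1) (x *m F.1) = dot x x.
Proof.
have [EE _ _] := F_adapted.
have E1 : (F.1 *m dmap g p) *m (F.1 *m dmap g p)^T = 1%:M.
  by apply/matrixP => i j; rewrite -dot_row !row_mul [LHS]EE mxE.
rewrite /metric -mulmxA; set D := F.1 *m dmap g p in E1 *.
by rewrite /dot trmx_mul mulmxA -(mulmxA x) E1 mulmx1.
Qed.

Lemma frame_unit : F.1 \in unitmx.
Proof.
have [EE _ _] := F_adapted.
have E1 : F.1 *m (dmap g p *m (F.1 *m dmap g p)^T) = 1%:M.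
  by rewrite mulmxA; apply/matrixP => i j; rewrite -dot_row !row_mul [LHS]EE mxE.
by case: (mulmx1_unit E1).
Qed.

(** The doubled angle: [B(x e0 + y e1, x e0 + y e1)] has coordinates
    [x^2 - y^2] and [2 x y] on [B(e0, e0)] and [B(e0, e1)]. *)
Lemma curvature_ellipseE :
  curvature_ellipse g p = ellipse (second_ff g p e0 e0) (second_ff g p e0 e1).
Proof.
have l1 : lift ord0 ord0 = 1 :> 'I_2 by apply: val_inj.
have rowE (x : 'rV[R]_2) : x *m F.1 = x 0 0 *: e0 + x 0 1 *: e1.
  by rewrite mulmx_sum_row big_ord_recl big_ord1 l1.
have ffE (x y : R) : second_ff g p (x *: e0 + y *: e1) (x *: e0 + y *: e1) =
   (x ^+ 2 - y ^+ 2) *: second_ff g p e0 e0 + (2 * x * y) *: second_ff g p e0 e1.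
  by rewrite second_ff_diag second_ff_traceless scalerN scalerBl addrAC.
have dot2 (x : 'rV[R]_2) : dot x x = x 0 0 ^+ 2 + x 0 1 ^+ 2.
  by rewrite dotE big_ord_recl big_ord1 l1.
apply/seteqP; split => z.
  move=> [X X1 <-]; move: X1; rewrite -(mulmxKV frame_unit X) /=.
  set x := _ *m invmx _; rewrite metric_frame rowE ffE => x1.
  have {}x1 : x 0 0 ^+ 2 + x 0 1 ^+ 2 = 1.
    by rewrite -dot2 -[LHS]sqr_sqrtr ?dot_ge0// x1 expr1n.
  have [t [<- <-]] : exists t, cos t = x 0 0 ^+ 2 - x 0 1 ^+ 2 /\
      sin t = 2 * x 0 0 * x 0 1.
    apply: circle_param; transitivity ((x 0 0 ^+ 2 + x 0 1 ^+ 2) ^+ 2); first ring.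
    by rewrite x1 expr1n.
  by exists t.
(* The ellipse is covered twice; [t / 2] is one of the two preimages of [t]. *)
move=> [t _ <-].
pose x : 'rV[R]_2 := \row_i (if i == 0 then cos (t / 2) else sin (t / 2)).
exists (x *m F.1) => /=.
  by rewrite metric_frame dot2 !mxE /= cos2Dsin2 sqrtr1.
rewrite rowE ffE !mxE /=; have -> : t = t / 2 + t / 2 by lra.
rewrite [in RHS]cosD [in RHS]sinD.
have -> : (t / 2 + t / 2) / 2 = t / 2 by lra.
congr (_ *: _ + _ *: _); ring.
Qed.

(** After the substitution [h^a_11 = - h^a_00], [h^a_10 = h^a_01] this is a
    polynomial identity: by Lagrange's identity the squares of the normal
    curvature coefficients add up to [16 (|a|^2 |b|^2 - <a, b>^2)], where
    [a = B 0 0] and [b = B 0 1]. *)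
Lemma ff_coef_curvature :
  let h := ff_coef g p F in
  let B i j := second_ff g p (row i F.1) (row j F.1) in
  (\sum_(a < 3) (h a 0 0 * h a 1 1 - h a 0 1 ^+ 2)) ^+ 2
    - 1 / 4 * (\sum_(i < 2) \sum_(j < 2) \sum_(a < 3) \sum_(b < 3)
        (\sum_(k < 2) (h a k i * h b k j - h a k j * h b k i)) ^+ 2) =
  (dot (B 0 0) (B 0 0) - dot (B 0 1) (B 0 1)) ^+ 2
    + 4 * dot (B 0 0) (B 0 1) ^+ 2.
Proof.
move=> h B.
have h11 a : h a 1 1 = - h a 0 0 by apply/eqP; rewrite -addr_eq0 addrC h_minimal.
have h10 a : h a 1 0 = h a 0 1 by rewrite /h /ff_coef second_ffC.
have dotB i j k l : dot (B i j) (B k l) = \sum_a h a i j * h a k l.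
  exact: dot_second_ff.
clearbody h B; rewrite !dotB.
have sum2 (f : 'I_2 -> R) : \sum_i f i = f 0 + f 1.
  by rewrite big_ord_recl big_ord1; congr (_ + f _); apply: val_inj.
have sum3 (f : 'I_3 -> R) : \sum_i f i = f 0 + f 1 + f 2.
  rewrite !big_ord_recl big_ord0 addr0 addrA.
  by congr (_ + f _ + f _); apply: val_inj.
by rewrite !sum2 !sum3 !sum2 !h11 !h10; field.
Qed.

End Surface.

(** * The superminimality criterion *)

Lemma sum_sqr_eq0 (R : realType) (x y z : R) :
  (x - y) ^+ 2 + 4 * z ^+ 2 = 0 <-> x = y /\ z = 0.
Proof.
split=> [H|[-> ->]]; last by ring.
have x2 := sqr_ge0 (x - y); have z2 := sqr_ge0 z.
have /eqP : (x - y) ^+ 2 = 0 by lra.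
have /eqP : z ^+ 2 = 0 by lra.
by rewrite !sqrf_eq0 subr_eq0 => /eqP -> /eqP ->.
Qed.

Theorem mainTheorem2 (R : realType) (M : surface R) (g : M -> 'rV[R]_6)
    (g_immersion : sphere_immersion g) (M_complete : complete_surface g)
    (g_minimal : minimal g) :
  superminimal g <->
  (forall p : M, (gauss_curvature g p - 1) ^+ 2
                 - 1 / 4 * scalar_normal_curvature g p = 0).
Proof.
suff equiv p : is_circle (curvature_ellipse g p) <->
    (gauss_curvature g p - 1) ^+ 2 - 1 / 4 * scalar_normal_curvature g p = 0.
  split=> [[_ circ] p|K0]; first exact/equiv/circ.
  by split=> // p; apply/equiv.
have F_adapted := adapted_frame_atP p g_immersion.
rewrite (curvature_ellipseE g_immersion F_adapted); last exact: g_minimal.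
rewrite ellipse_is_circle.
have -> : gauss_curvature g p - 1 = \sum_(a < 3)
    (ff_coef g p (adapted_frame_at g p) a 0 0 * ff_coef g p (adapted_frame_at g p) a 1 1
     - ff_coef g p (adapted_frame_at g p) a 0 1 ^+ 2).
  by rewrite /gauss_curvature addrAC subrr add0r.
rewrite (ff_coef_curvature g_immersion F_adapted); last exact: g_minimal.
by rewrite sum_sqr_eq0.
Qed.
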